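(* For every $\varepsilon \geq 0$ and every $n \in \mathbb{N}$, and every $p$ with $\frac{2000 \log n}{n} \leq p \leq n^{-\frac12 - \varepsilon}$, there exists an algorithm in the distance query model that reconstructs $G \sim G(n,p)$ (i.e. determines its edge set exactly) using $O(\Delta^2 n \log n)$ queries in expectation, where $\Delta = (n-1)p$ is the expected average degree of $G$.
   Context: Distance query model: we are given the vertex set $V$ of an $n$-vertex graph $G=(V,E)$ (with $E$ hidden) and an oracle which, on input two vertices $u,v \in V$, returns the shortest-path distance $d_G(u,v)$ in $G$. Each call to the oracle is one query; reconstructing $G$ means determining $E$ exactly. $G(n,p)$ denotes the Erdős–Rényi–Gilbert random graph on $n$ vertices in which each pair is an edge independently with probability $p$. The expectation is over both the randomness of $G$ and the internal randomness of the algorithm. $\log$ denotes the natural logarithm. *)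

(* Defs.v *)
From HB Require Import structures.
From mathcomp Require Import all_boot all_order all_algebra.
From mathcomp Require Import reals exp.
Set Implicit Arguments. Unset Strict Implicit. Unset Printing Implicit Defensive.
Import Order.TTheory GRing.Theory Num.Theory.
Local Open Scope ring_scope.

Definition graph (n : nat) := {ffun 'I_n * 'I_n -> bool}.

Definition is_simple n (g : graph n) : bool :=
  [forall x : 'I_n, ~~ g (x, x)] && [forall x : 'I_n, forall y : 'I_n, g (x, y) == g (y, x)].

(** unordered pairs {u,v}, represented as (u,v) with u < v *)
Definition vpairs n : {set 'I_n * 'I_n} := [set e : 'I_n * 'I_n | (val e.1 < val e.2)%N].
Definition edges n (g : graph n) : {set 'I_n * 'I_n} := [set e in vpairs n | g e].

Definition gnp_prob (R : realType) n (p : R) (g : graph n) : R :=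
  if is_simple g then p ^+ #|edges g| * (1 - p) ^+ (#|vpairs n| - #|edges g|)%N else 0.

Fixpoint ball n (g : graph n) (u : 'I_n) (k : nat) : {set 'I_n} :=
  match k with
  | 0 => [set u]
  | k.+1 => ball g u k :|: [set y | [exists x in ball g u k, g (x, y)]]
  end.

(** Shortest-path distance d_G(u,v): Some d, or None (= infinity) if v is
    not reachable from u.  Any finite distance is < n. *)
Definition dist n (g : graph n) (u v : 'I_n) : option nat :=
  let k := find (fun k => v \in ball g u k) (iota 0 n) in
  if (k < n)%N then Some k else None.

(** Deterministic adaptive algorithms in the distance query model:
    decision trees whose internal nodes query the oracle on a pair (u,v)
    and branch on the answer, and whose leaves output a graph. *)
Inductive qtree (n : nat) : Type :=
  | Output of graph n
  | Query of 'I_n & 'I_n & (option nat -> qtree n).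

Fixpoint run_output n (t : qtree n) (g : graph n) : graph n :=
  match t with
  | Output h => h
  | Query u v k => run_output (k (dist g u v)) g
  end.

Fixpoint run_cost n (t : qtree n) (g : graph n) : nat :=
  match t with
  | Output _ => 0
  | Query u v k => (run_cost (k (dist g u v)) g).+1
  end.

Definition reconstructs n (t : qtree n) : Prop :=
  forall g : graph n, is_simple g -> run_output t g = g.

Definition expected_cost (R : realType) n (p : R) (t : qtree n) : R :=
  \sum_(g : graph n) gnp_prob p g * (run_cost t g)%:R.

(* Main.v *)
(* Let D = np + 1 and let S be a multiset of m ~ 256 D^2 log n uniformly random
   landmarks. Query all pairs in V x S, and then only those pairs {u, v} that no
   landmark s separates, meaning |d(u, s) - d(v, s)| >= 2; a separated pair is not
   an edge, so the output is always correct. When n < 257 D^2 log n, querying all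
   pairs is cheap enough.

   For the cost, fix u and v non-adjacent and choose k with
   D^(k+1) <= n/16 < D^(k+2). Explore the ball of radius k around v in G - u, and
   then the ball of radius k around u in the unexplored part. Vertices at distance
   k from u that have no edge to the last layer around v are at distance at least
   k + 2 from v, unless a shortest path to v runs through u; either way they
   separate u and v. Exponential moments of layer sizes are computed one step of
   the search at a time: the ball around v has at most 4 D^k vertices except with
   probability 1/n, and the Laplace transform of the layer around u shows that the
   expected probability of S missing all of about D^k >= n / (16 D^2) separating
   vertices is at most 3/n. So O(n + n^2 p) pairs on average are queried in the
   second phase. *)

Require Import Defs.
From HB Require Import structures.
From mathcomp Require Import all_boot all_order all_algebra.
From mathcomp Require Import reals exp.
From mathcomp Require Import sequences ring lra.
Set Implicit Arguments. Unset Strict Implicit. Unset Printing Implicit Defensive.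
Import Order.TTheory GRing.Theory Num.Theory.
Local Open Scope ring_scope.

(** * Independence in G(n, p) *)

Section ProductMeasure.
Variables (R : realType) (n : nat) (p : R).
Implicit Types (w : graph n) (e : 'I_n * 'I_n) (P Q : pred ('I_n * 'I_n)).

Definition bern (b : bool) : R := if b then p else 1 - p.
(** Independent bits on all ordered pairs make [graph n] itself the sample space; [symg] later reads
    only the pairs (u, v) with u < v. *)
Definition mu w : R := \prod_e bern (w e).
Definition Ex (f : graph n -> R) : R := \sum_w mu w * f w.

Lemma eq_Ex f g : f =1 g -> Ex f = Ex g.
Proof. by move=> fg; apply: eq_bigr => w _; rewrite fg. Qed.

Lemma ExZ a f : Ex (fun w => a * f w) = a * Ex f.
Proof. by rewrite /Ex mulr_sumr; apply: eq_bigr => w _; rewrite mulrCA. Qed.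

Lemma ExD f g : Ex (fun w => f w + g w) = Ex f + Ex g.
Proof. by rewrite /Ex -big_split; apply: eq_bigr => w _; rewrite mulrDr. Qed.

Lemma Ex_sum (I : finType) (A : pred I) (f : I -> graph n -> R) :
  Ex (fun w => \sum_(i | A i) f i w) = \sum_(i | A i) Ex (f i).
Proof.
by rewrite /Ex exchange_big /=; apply: eq_bigr => w _; rewrite mulr_sumr.
Qed.

Lemma sum_bern : \sum_b bern b = 1.
Proof. by rewrite big_bool /bern /= addrC subrK. Qed.

Lemma Ex_cst a : Ex (fun=> a) = a.
Proof.
rewrite /Ex -mulr_suml -(bigA_distr_bigA (fun _ b => bern b)) /=.
by rewrite (eq_bigr (fun=> 1)) ?big1_eq ?mul1r // => e _; exact: sum_bern.
Qed.

Lemma Ex_coord e (f : bool -> R) : Ex (fun w => f (w e)) = p * f true + (1 - p) * f false.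
Proof.
pose F e' b := bern b * (if e' == e then f b else 1).
rewrite /Ex (eq_bigr (fun w : graph n => \prod_e' F e' (w e'))); last first.
  move=> w _; rewrite big_split /=; congr (_ * _).
  by rewrite -big_mkcond big_pred1_eq.
rewrite -bigA_distr_bigA /= (bigD1 e) //= [X in _ * X]big1 ?mulr1.
  by rewrite big_bool /F eqxx.
move=> e' /negPf e'e; rewrite -sum_bern; apply: eq_bigr => b _.
by rewrite /F e'e mulr1.
Qed.

Definition mix P w w' : graph n := [ffun e => if P e then w e else w' e].

Lemma mixE P w w' e : mix P w w' e = if P e then w e else w' e.
Proof. by rewrite ffunE. Qed.

Lemma mu_mix P w w' : mu (mix P w w') * mu (mix P w' w) = mu w * mu w'.
Proof.
rewrite /mu -!big_split /=; apply: eq_bigr => e _; rewrite !mixE.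
by case: ifP => // _; rewrite mulrC.
Qed.

(* Independence of disjoint sets of coordinates, by swapping the coordinates
   outside [P] of two independent samples. *)
Lemma Ex_split P (H : graph n -> graph n -> R) :
  (forall w w', H w w' = H (mix P w w') (mix P w w')) ->
  Ex (fun w => H w w) = Ex (fun w => Ex (H w)).
Proof.
move=> HP; pose sw (x : graph n * graph n) := (mix P x.1 x.2, mix P x.2 x.1).
have swK : involutive sw.
  by case=> w w'; congr (_, _); apply/ffunP=> e; rewrite !ffunE; case: (P e).
rewrite /Ex (eq_bigr (fun w => \sum_w' mu w * mu w' * H w w)); last first.
  move=> w _; rewrite -mulr_suml -mulr_sumr.
  by have := Ex_cst 1; rewrite /Ex; under eq_bigr do rewrite mulr1; move=> ->; rewrite mulr1.
under [RHS]eq_bigr do rewrite mulr_sumr.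
rewrite !pair_bigA /= (reindex_inj (inv_inj swK)) /=.
by apply: eq_bigr => -[w w'] _ /=; rewrite mu_mix -HP mulrA.
Qed.

(** Measurability with respect to the coordinates in [P]. *)
Definition dep (T : Type) P (f : graph n -> T) :=
  forall w w', {in P, w =1 w'} -> f w = f w'.

Lemma mix_in P w w' : {in P, mix P w w' =1 w}.
Proof. by move=> e eP; rewrite mixE (eP : P e). Qed.

Lemma mix_notin P w w' : {in predC P, mix P w w' =1 w'}.
Proof. by move=> e eP; rewrite mixE (negPf (eP : ~~ P e)). Qed.

Lemma Ex_prod (I : finType) (A : {set I}) (C : I -> pred ('I_n * 'I_n)) (h : I -> graph n -> R) :
  (forall i, i \in A -> dep (C i) (h i)) ->
  (forall i j e, i \in A -> j \in A -> e \in C i -> e \in C j -> i = j) ->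
  Ex (fun w => \prod_(i in A) h i w) = \prod_(i in A) Ex (h i).
Proof.
move=> hC Cdisj; under eq_Ex do rewrite -big_enum; rewrite -big_enum /=.
have: {subset enum A <= A} by move=> i; rewrite mem_enum.
elim: (enum A) (enum_uniq A) => [|i r IH] /=.
  by move=> _ _; under eq_Ex do rewrite big_nil; rewrite big_nil Ex_cst.
move=> /andP[ir ur] rA.
have iA : i \in A by apply: rA; rewrite mem_head.
have {}rA : {subset r <= A} by move=> j jr; apply: rA; rewrite inE jr orbT.
rewrite big_cons -(IH ur rA).
under eq_Ex do rewrite big_cons.
rewrite (@Ex_split (C i) (fun w w' => h i w * \prod_(j <- r) h j w')); last first.
  move=> w w'; congr (_ * _); first by apply: hC => // e eC; rewrite mix_in.
  rewrite big_seq [RHS]big_seq; apply: eq_bigr => j jr; apply: hC; first exact: rA.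
  move=> e eC; rewrite mix_notin // inE; apply/negP => eCi.
  by move: ir; rewrite (Cdisj i j e) ?jr // rA.
under eq_Ex do rewrite ExZ mulrC.
by rewrite ExZ mulrC.
Qed.

Hypotheses (p0 : 0 <= p) (p1 : p <= 1).

Lemma mu_ge0 w : 0 <= mu w.
Proof. by apply: prodr_ge0 => e _; rewrite /bern; case: ifP => _; rewrite ?subr_ge0. Qed.

Lemma le_Ex f g : (forall w, f w <= g w) -> Ex f <= Ex g.
Proof. by move=> fg; apply: ler_sum => w _; rewrite ler_wpM2l ?mu_ge0. Qed.

Lemma Ex_le_cst f a : (forall w, f w <= a) -> Ex f <= a.
Proof. by move=> fa; rewrite -[leRHS]Ex_cst le_Ex. Qed.

End ProductMeasure.

(** * Random graphs as symmetrized bit arrays, and the law of a neighbourhood *)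

Section RandomGraph.
Variables (R : realType) (n : nat) (p : R).
Implicit Types (w g : graph n) (x y u v : 'I_n) (A U X Y : {set 'I_n}).

Definition ordpair x y : 'I_n * 'I_n := if (val x < val y)%N then (x, y) else (y, x).

Definition symg w : graph n := [ffun e => (e.1 != e.2) && w (ordpair e.1 e.2)].

Lemma symgE w x y : symg w (x, y) = (x != y) && w (ordpair x y).
Proof. by rewrite ffunE. Qed.

Lemma ordpairC x y : ordpair x y = ordpair y x.
Proof. by rewrite /ordpair; case: ltngtP => // /val_inj ->. Qed.

Lemma symgC w x y : symg w (x, y) = symg w (y, x).
Proof. by rewrite !symgE eq_sym ordpairC. Qed.

Lemma symg_simple w : is_simple (symg w).
Proof.
apply/andP; split; first by apply/forallP=> x; rewrite symgE eqxx.
by apply/forallP=> x; apply/forallP=> y; rewrite symgC.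
Qed.

Lemma simpleC g : is_simple g -> forall x y, g (x, y) = g (y, x).
Proof. by case/andP=> _ /forallP gs x y; have /forallP/(_ y)/eqP := gs x. Qed.

Lemma simple_irr g : is_simple g -> forall x, g (x, x) = false.
Proof. by case/andP=> /forallP gi _ x; apply/negbTE. Qed.

Lemma ordpair_vpairs x y : x != y -> ordpair x y \in vpairs n.
Proof.
move=> xy; rewrite inE /ordpair; case: ifP => //= /negbT; rewrite -leqNgt leq_eqVlt.
by case/orP=> // /eqP /val_inj yx; rewrite yx eqxx in xy.
Qed.

Lemma symg_id g w : is_simple g -> {in vpairs n, w =1 g} -> symg w = g.
Proof.
move=> gs wg; apply/ffunP=> -[x y]; rewrite symgE.
case: eqVneq => [->|xy] /=; first by rewrite simple_irr.
by rewrite wg ?ordpair_vpairs // /ordpair; case: ifP => // _; rewrite simpleC.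
Qed.

Lemma symg_vpairs w : {in vpairs n, symg w =1 w}.
Proof.
move=> [x y]; rewrite inE /= symgE => xy; rewrite /ordpair xy.
by case: eqVneq xy => // ->; rewrite ltnn.
Qed.

(** The fibre of [symg] over a simple graph fixes the bits on [vpairs n] and leaves all others free;
    the free bits sum to 1. *)
Lemma gnp_Ex (F : graph n -> R) : \sum_g gnp_prob p g * F g = Ex p (fun w => F (symg w)).
Proof.
rewrite /Ex [RHS](partition_big symg xpredT) //=; apply: eq_bigr => g _.
rewrite (eq_bigr (fun w => mu p w * F g)); last by move=> w /eqP ->.
rewrite -mulr_suml; congr (_ * _); rewrite /gnp_prob; case: ifPn => gs; last first.
  by rewrite big1 // => w /eqP wg; rewrite -wg symg_simple in gs.
pose Q (e : 'I_n * 'I_n) : pred bool := fun b => (e \in vpairs n) ==> (b == g e).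
rewrite (eq_bigl (fun w : graph n => w \in family Q)); last first.
  move=> w; apply/eqP/familyP => [wg e|wQ].
    by rewrite unfold_in; apply/implyP => eV; rewrite -wg symg_vpairs.
  by apply: symg_id => // e eV; have := wQ e; rewrite unfold_in eV => /eqP.
rewrite -(bigA_distr_big_dep Q (fun _ b => bern p b)) /=.
rewrite (bigID (mem (vpairs n))) /= [X in _ = _ * X]big1 ?mulr1 => [|e /negPf eV]; last first.
  by rewrite /Q eV /= sum_bern.
rewrite (eq_bigr (fun e => bern p (g e))) => [|e eV]; last first.
  by rewrite /Q /= eV /= big_pred1_eq.
rewrite (bigID (fun e => g e)) /=; congr (_ * _).
  rewrite (eq_bigr (fun=> p)) => [|e /andP[_ ge]]; last by rewrite /bern ge.
  rewrite prodr_const; congr (_ ^+ _); apply: eq_card => e.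
  by rewrite [RHS]inE [LHS]inE.
rewrite (eq_bigr (fun=> 1 - p)) => [|e /andP[_ /negPf ge]]; last by rewrite /bern ge.
rewrite prodr_const; congr (_ ^+ _).
have -> : edges g = vpairs n :&: [set e | g e] by apply/setP=> e; rewrite !inE.
rewrite -[X in (X - _)%N](cardsID [set e | g e] (vpairs n)) addKn; apply: eq_card => e.
by rewrite [RHS]inE [LHS]inE inE andbC.
Qed.

Lemma Ex_edge x y : x != y -> Ex p (fun w => (symg w (x, y))%:R) = p.
Proof.
move=> xy; under eq_Ex do rewrite symgE xy /=.
by rewrite (Ex_coord p _ (fun b => b%:R)) /= mulr1 mulr0 addr0.
Qed.

(** Closed under swapping, because [ordpair] may reverse a pair. *)
Definition btw X Y : pred ('I_n * 'I_n) :=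
  fun e => (e.1 \in X) && (e.2 \in Y) || (e.2 \in X) && (e.1 \in Y).

Lemma btwE X Y e :
  (e \in btw X Y) = (e.1 \in X) && (e.2 \in Y) || (e.2 \in X) && (e.1 \in Y).
Proof. by []. Qed.

Lemma btw_ordpair X Y x y : x \in X -> y \in Y -> ordpair x y \in btw X Y.
Proof. by move=> xX yY; rewrite btwE /ordpair; case: ifP => /= _; rewrite xX yY ?orbT. Qed.

Lemma btw_sub X Y X' Y' : X \subset X' -> Y \subset Y' -> {subset btw X Y <= btw X' Y'}.
Proof.
move=> /subsetP XX' /subsetP YY' e; rewrite !btwE.
by case/orP=> /andP[/XX' -> /YY' ->]; rewrite ?orbT.
Qed.

Lemma symg_dep X Y x y : x \in X -> y \in Y -> dep (btw X Y) (fun w => symg w (x, y)).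
Proof. by move=> xX yY w w' ww'; rewrite !symgE ww' // btw_ordpair. Qed.

Definition nb g A U : {set 'I_n} := [set y in U | [exists x in A, g (x, y)]].

Lemma nb_subset g A U : nb g A U \subset U.
Proof. by apply/subsetP=> y; rewrite inE => /andP[]. Qed.

Lemma nb_dep A U : dep (btw A U) (fun w => nb (symg w) A U).
Proof.
move=> w w' ww'; apply/setP=> y; rewrite !inE; case: (boolP (y \in U)) => //= yU.
apply: eq_existsb => x; case: (boolP (x \in A)) => //= xA.
exact: (symg_dep xA yU ww').
Qed.

(** Pairs in [btw A U] have an end in [A], pairs in [btw X Y] have none: revealing the former leaves
    the latter fresh. *)
Lemma btw_disj A U X Y : [disjoint A & U] -> [disjoint A & X] -> [disjoint A & Y] ->
  {subset btw X Y <= predC (btw A U)}.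
Proof.
move=> AU AX AY e eXY; rewrite inE; apply/negP; move: eXY; rewrite !btwE.
have dj (B : {set 'I_n}) z : [disjoint A & B] -> z \in A -> z \in B -> False.
  by move=> /disjoint_setI0/setP/(_ z); rewrite !inE => /negbT; rewrite negb_and => /orP[] /negP.
case/orP=> /andP[aX bY] /orP[] /andP[cA dU];
  by [exact: dj AX cA _ | exact: dj AY cA _].
Qed.

Lemma nb_avoid A y : y \notin A ->
  Ex p (fun w => (~~ [exists x in A, symg w (x, y)])%:R) = (1 - p) ^+ #|A|.
Proof.
move=> yA; rewrite -prodr_const.
under eq_Ex => w.
  have -> : (~~ [exists x in A, symg w (x, y)])%:R = \prod_(x in A) (~~ symg w (x, y))%:R :> R.
    case: existsP => [[x /andP[xA wx]]|nex] /=.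
      by rewrite (bigD1 x) //= wx mul0r.
    by rewrite big1 // => x xA; case wx: (symg w (x, y)) => //; case: nex; exists x; rewrite xA.
  over.
rewrite (@Ex_prod _ _ p _ A (fun x => btw [set x] [set y])).
- apply: eq_bigr => x xA.
  have xy : x != y by apply: contraNneq yA => <-.
  under eq_Ex do rewrite symgE xy /=.
  by rewrite (Ex_coord p _ (fun b => (~~ b)%:R)) /= mulr1 mulr0 add0r.
- by move=> x xA w w' ww'; rewrite (symg_dep (set11 x) (set11 y) ww').
move=> x x' e xA x'A; rewrite !btwE !inE.
have xy z : z \in A -> (z == y) = false by move=> zA; apply: contraNF yA => /eqP <-.
by case/orP=> /andP[/eqP-> /eqP->]; rewrite eqxx (eq_sym y) !xy ?(andbT, andbF, orbF) //= => /eqP.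
Qed.

(** Each vertex of [U] is hit independently with probability 1 - (1 - p)^|A|, so this is the
    generating function of a binomial variable. *)
Lemma nb_mgf A U (z : R) : [disjoint A & U] ->
  Ex p (fun w => z ^+ #|nb (symg w) A U|)
  = (1 + (1 - (1 - p) ^+ #|A|) * (z - 1)) ^+ #|U|.
Proof.
move=> AU; rewrite -prodr_const.
pose h y w : R := z + (1 - z) * (~~ [exists x in A, symg w (x, y)])%:R.
under eq_Ex => w.
  have -> : z ^+ #|nb (symg w) A U| = \prod_(y in U) h y w.
    rewrite -prodr_const (eq_bigl (fun y => (y \in U) && [exists x in A, symg w (x, y)])).
      rewrite big_mkcondr; apply: eq_bigr => y _; rewrite /h.
      by case: ifP => _ /=; rewrite ?mulr0 ?addr0 ?mulr1 // addrC subrK.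
    by move=> y; rewrite inE.
  over.
have AUf y : y \in U -> y \notin A.
  by move=> yU; apply/negP => yA; have /disjoint_setI0/setP/(_ y) := AU; rewrite !inE yA yU.
rewrite (@Ex_prod _ _ p _ U (fun y => btw A [set y])).
- apply: eq_bigr => y yU; rewrite /h ExD ExZ Ex_cst nb_avoid ?AUf //; ring.
- move=> y yU w w' ww'; rewrite /h; congr (_ + _ * (~~ _)%:R).
  apply: eq_existsb => x; case: (boolP (x \in A)) => //= xA.
  exact: (symg_dep xA (set11 y) ww').
move=> y y' e yU y'U; rewrite !btwE !inE.
by case/orP=> /andP[eA /eqP ey]; rewrite ey eA /= ?(negPf (AUf _ yU)) //= ?orbF => /eqP.
Qed.

End RandomGraph.

(** * Breadth-first search and exponential moments *)

Section ExpBounds.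
Variable R : realType.
Implicit Types x y z : R.

Lemma bernoulli_ineq x k : 0 <= x -> x <= 1 -> 1 - k%:R * x <= (1 - x) ^+ k.
Proof.
move=> x0 x1; elim: k => [|k IH]; first by rewrite mul0r subr0.
rewrite exprS; apply: le_trans (ler_wpM2l _ IH); last by rewrite subr_ge0.
have k0 : 0 <= k%:R :> R by [].
rewrite -natr1; nra.
Qed.

Lemma expR_sub1_le y : 1 < y -> expR y^-1 - 1 <= (y - 1)^-1.
Proof.
move=> y1; have y0 : 0 < y by apply: lt_trans y1.
have h : 1 - y^-1 <= expR (- y^-1) by rewrite expR_ge1Dx.
have d0 : 0 < 1 - y^-1 by rewrite subr_gt0 invf_lt1.
have : expR y^-1 <= (1 - y^-1)^-1.
  by rewrite -[y^-1 in leLHS]opprK expRN lef_pV2 // posrE ?expR_gt0.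
rewrite -(lerD2r (-1)) => /le_trans; apply; rewrite le_eqVlt; apply/orP; left; apply/eqP.
by field; rewrite !gt_eqF // subr_gt0.
Qed.

Lemma one_sub_expRN_ge x : 0 <= x -> x / (1 + x) <= 1 - expR (- x).
Proof.
move=> x0; have d0 : 0 < 1 + x by rewrite ltr_wpDr.
have : expR (- x) <= (1 + x)^-1 by rewrite expRN lef_pV2 ?posrE ?expR_gt0 // expR_ge1Dx.
rewrite -lerN2 -(lerD2l 1); apply: le_trans; rewrite le_eqVlt; apply/orP; left; apply/eqP.
by field; rewrite gt_eqF.
Qed.

Lemma one_add_pow_le x k : 0 <= 1 + x -> (1 + x) ^+ k <= expR (k%:R * x).
Proof. by move=> x0; rewrite expRM_natl lerXn2r ?nnegrE ?expR_ge0 // expR_ge1Dx. Qed.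

Lemma expR_half_le2 : expR (2^-1 : R) <= 2.
Proof.
have := expR_ge1Dx (- 2^-1 : R); rewrite expRN => h2.
have h3 : 2^-1 <= (expR 2^-1)^-1 :> R by lra.
by rewrite lef_pV2 ?posrE ?expR_gt0 in h3.
Qed.

End ExpBounds.

(** * Moments of the layers of a search *)

Section Exploration.
Variables (R : realType) (n : nat) (p : R).
Implicit Types (w g : graph n) (u v : 'I_n) (A U X Y L N : {set 'I_n}).

(* Breadth-first search from the set [A] inside [A :|: U]: [layer] is the set at
   distance exactly [j], [rest] the vertices not reached within [j] steps, and
   [reached] the number of vertices reached. *)
Fixpoint layer g j A U : {set 'I_n} :=
  if j is j'.+1 then layer g j' (nb g A U) (U :\: nb g A U) else A.

Fixpoint rest g j A U : {set 'I_n} :=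
  if j is j'.+1 then rest g j' (nb g A U) (U :\: nb g A U) else U.

Fixpoint reached g j A U : nat :=
  if j is j'.+1 then (#|A| + reached g j' (nb g A U) (U :\: nb g A U))%N else #|A|.

Lemma card_nb_diff g A U : (#|nb g A U| + #|U :\: nb g A U| = #|U|)%N.
Proof. by rewrite -(cardsID (nb g A U) U) (setIidPr (nb_subset g A U)). Qed.

Lemma nb_union g A U : nb g A U :|: (U :\: nb g A U) = U.
Proof. by rewrite -{1}(setIidPr (nb_subset g A U)) setID. Qed.

Lemma nb_disjoint g A U : [disjoint nb g A U & U :\: nb g A U].
Proof. by rewrite disjoint_sym -setI_eq0 setIDAC -setIDA setDv setI0. Qed.

Lemma reached_rest g j A U : (reached g j A U + #|rest g j A U| = #|A| + #|U|)%N.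
Proof.
by elim: j A U => //= j IH A U; rewrite -addnA IH card_nb_diff.
Qed.

Lemma layer_le_reached g j A U : (#|layer g j A U| <= reached g j A U)%N.
Proof. by elim: j A U => //= j IH A U; rewrite (leq_trans (IH _ _)) ?leq_addl. Qed.

Lemma layer_rest_subset g j A U : layer g j A U :|: rest g j A U \subset A :|: U.
Proof.
elim: j A U => //= j IH A U; apply: subset_trans (IH _ _) _.
by rewrite nb_union subsetUr.
Qed.

Lemma layerS_subset g j A U : layer g j.+1 A U \subset U.
Proof.
have := layer_rest_subset g j (nb g A U) (U :\: nb g A U).
by rewrite nb_union subUset => /andP[].
Qed.

Lemma layer_rest_disjoint g j A U : [disjoint A & U] -> [disjoint layer g j A U & rest g j A U].
Proof. by elim: j A U => //= j IH A U _; apply/IH/nb_disjoint. Qed.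

Lemma exploration_agree w w' j A U : {in btw (A :|: U) U, w =1 w'} ->
  [/\ layer (symg w) j A U = layer (symg w') j A U,
      rest (symg w) j A U = rest (symg w') j A U
    & reached (symg w) j A U = reached (symg w') j A U].
Proof.
elim: j A U => //= j IH A U ww'.
have -> : nb (symg w) A U = nb (symg w') A U.
  by apply: nb_dep => e eAU; apply: ww'; apply: btw_sub eAU => //; exact: subsetUl.
have [e|-> -> ->] := IH (nb (symg w') A U) (U :\: nb (symg w') A U); last by [].
rewrite nb_union => eU; apply: ww'; apply: btw_sub eU; [exact: subsetUr|exact: subsetDl].
Qed.

(** Deferred decisions: the pairs between [A] and [U] are revealed first, then all other coordinates
    are resampled. *)
Lemma Ex_nb A U (F : {set 'I_n} -> graph n -> R) :
  (forall N, N \subset U -> dep (predC (btw A U)) (F N)) ->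
  Ex p (fun w => F (nb (symg w) A U) w) = Ex p (fun w => Ex p (F (nb (symg w) A U))).
Proof.
move=> dF; apply: (@Ex_split _ _ _ (btw A U) (fun w w' => F (nb (symg w) A U) w')) => w w'.
have -> : nb (symg (mix (btw A U) w w')) A U = nb (symg w) A U.
  by apply: nb_dep => e eAU; rewrite mix_in.
by apply: dF; [exact: nb_subset | move=> e eAU; rewrite mix_notin].
Qed.

Lemma nb_split_dep w w' A U N : [disjoint A & U] -> N \subset U ->
  {in predC (btw A U), w =1 w'} -> {in btw (N :|: (U :\: N)) (U :\: N), w =1 w'}.
Proof.
move=> AU NU ww' e eN; apply: ww'; apply: (@btw_disj _ _ _ U U) => //.
by apply: btw_sub eN; rewrite ?subsetDl // subUset NU subsetDl.
Qed.

Hypotheses (p0 : 0 <= p) (p1 : p <= 1).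

(** Deferred decisions over [j] steps: given the last layer [L] and the rest [Y], the pairs between
    [L :|: Y] and [Y] are still unrevealed, as are those of [Z], which leave [A :|: U]. *)
Lemma exploration_le j A U (Z : pred ('I_n * 'I_n)) (F : {set 'I_n} -> {set 'I_n} -> graph n -> R) (c : R) :
  [disjoint A & U] ->
  {subset Z <= predC (btw (A :|: U) (A :|: U))} ->
  (forall L Y, dep [predU btw (L :|: Y) Y & Z] (F L Y)) ->
  (forall L Y, L :|: Y \subset A :|: U -> [disjoint L & Y] -> Ex p (F L Y) <= c) ->
  Ex p (fun w => F (layer (symg w) j A U) (rest (symg w) j A U) w) <= c.
Proof.
move=> + + dF; elim: j A U => [|j IH] A U AU ZAU Fc /=; first exact: Fc.
pose K N w := F (layer (symg w) j N (U :\: N)) (rest (symg w) j N (U :\: N)) w.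
rewrite (@Ex_nb A U K) => [|N NU w w' ww'].
  apply: Ex_le_cst => // w; apply: IH; first exact: nb_disjoint.
    rewrite nb_union => e /ZAU; rewrite !inE; apply: contraNN; apply: btw_sub; exact: subsetUr.
  by move=> L Y; rewrite nb_union => LY; apply: Fc; apply: subset_trans LY (subsetUr _ _).
rewrite /K; have [-> -> _] := exploration_agree j (nb_split_dep AU NU ww').
apply: dF => e; rewrite inE => /orP[eLY|/ZAU]; last first.
  rewrite !inE => eAU; apply: ww'; rewrite inE; apply: contraNN eAU.
  by apply: btw_sub; rewrite ?subsetUl ?subsetUr.
apply: ww'; apply: (@btw_disj _ _ _ U U) => //.
have LYU : layer (symg w') j N (U :\: N) :|: rest (symg w') j N (U :\: N) \subset U.
  by apply: subset_trans (layer_rest_subset _ _ _ _) _; rewrite subUset NU subsetDl.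
by apply: btw_sub eLY => //; apply: subset_trans LYU; exact: subsetUr.
Qed.

Lemma nb_expR A U c : [disjoint A & U] ->
  Ex p (fun w => expR (#|nb (symg w) A U|%:R * c))
  = (1 + (1 - (1 - p) ^+ #|A|) * (expR c - 1)) ^+ #|U|.
Proof. by move=> AU; rewrite -nb_mgf //; apply: eq_Ex => w; rewrite expRM_natl. Qed.

Lemma powp_ge0 a : 0 <= 1 - (1 - p) ^+ a.
Proof. by rewrite subr_ge0 exprn_ile1 ?subr_ge0 // lerBlDr ler_wpDr. Qed.

Lemma powp_le a : 1 - (1 - p) ^+ a <= a%:R * p.
Proof. by rewrite lerBlDr -lerBlDl bernoulli_ineq. Qed.

(* [D] bounds the expected growth factor of a whole ball, not only of its last layer. *)
Let D := n%:R * p + 1.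

(* Since [exp (1 / y) - 1 <= 1 / (y - 1)], the recursion on exponents of the
   moment generating function becomes affine in the inverse exponent [y]. *)
Definition growth (y : R) := D * y + 1.

Lemma D_ge1 : 1 <= D. Proof. by rewrite lerDr mulr_ge0. Qed.

Lemma growth_gt y : 0 < y -> y < growth y.
Proof. by have := D_ge1; rewrite /growth => D1 y0; nra. Qed.

Lemma iter_growth_ge j y : 0 < y -> y <= iter j growth y.
Proof.
move=> y0; elim: j => //= j /le_trans; apply; apply/ltW/growth_gt.
by elim: j => //= j IH; apply: lt_trans IH (growth_gt IH).
Qed.

(** Induction on [j], revealing the first layer: scale [growth y] on the new layer turns into scale
    [y] on [A]. *)
Lemma reached_expR_le j A U y : 0 < y -> [disjoint A & U] ->
  Ex p (fun w => expR ((reached (symg w) j A U)%:R / iter j growth y)) <= expR (#|A|%:R / y).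
Proof.
elim: j A U y => [|j IH] A U y y0 AU; first by rewrite /= Ex_cst.
rewrite iterSr /=; set y' := growth y; have D1 := D_ge1.
have y'1 : 1 < y' by rewrite /y' /growth; nra.
have y'0 : 0 < y' by apply: lt_trans y'1.
set Y := iter j growth y'; have y'Y : y' <= Y by exact: iter_growth_ge.
have Y0 : 0 < Y by apply: lt_le_trans y'Y.
pose K N w := expR ((reached (symg w) j N (U :\: N))%:R / Y).
under eq_Ex => w do rewrite natrD mulrDl expRD.
rewrite ExZ (@Ex_nb A U K) => [|N NU w w' ww']; last first.
  by rewrite /K; have [_ _ ->] := exploration_agree j (nb_split_dep AU NU ww').
(* Since 1/D + np/D = 1, the budget |A|/y splits: one share pays for [A] itself, the other for the
   moment of the next layer. *)
have -> : #|A|%:R / y = #|A|%:R / y * (D^-1 + n%:R * p / D).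
  rewrite -[LHS]mulr1; congr (_ * _); rewrite -[X in X + _]mul1r -mulrDl addrC divff //.
  by rewrite gt_eqF // (lt_le_trans _ D1).
rewrite mulrDr expRD; apply: ler_pM; rewrite ?expR_ge0 //.
- by rewrite -[0](@Ex_cst _ n p); apply: le_Ex => // w; rewrite -[0](@Ex_cst _ n p); apply: le_Ex => // w'; exact: expR_ge0.
- rewrite ler_expR -mulrA ler_wpM2l // -invfM lef_pV2 ?posrE ?mulr_gt0 //; last by lra.
  by apply: le_trans y'Y; rewrite /y' /growth; nra.
apply: (@le_trans _ _ (Ex p (fun w => expR (#|nb (symg w) A U|%:R * y'^-1)))).
  by apply: le_Ex => // w; apply: IH => //; exact: nb_disjoint.
rewrite nb_expR //; have c1 := expR_sub1_le y'1.
have c0 : 0 <= expR y'^-1 - 1 by rewrite subr_ge0 -expR0 ler_expR invr_ge0 ltW.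
have q0 := powp_ge0 #|A|; have q1 := powp_le #|A|.
apply: le_trans (one_add_pow_le _ _) _; first by rewrite addr_ge0 ?mulr_ge0.
rewrite ler_expR.
have -> : #|A|%:R / y * (n%:R * p / D) = n%:R * (#|A|%:R * p * (y' - 1)^-1).
  rewrite /y' /growth addrK; field; rewrite !gt_eqF //; lra.
apply: ler_pM; rewrite ?mulr_ge0 //; last by apply: ler_pM.
by rewrite ler_nat -[leqRHS]card_ord; exact: max_card.
Qed.

Variables (t s : R).

(* At each of the [j] steps the layer is small, so that few edges collide, and
   the unexplored set is still large. *)
Fixpoint guard g j A U : bool :=
  if j is j'.+1 then [&& #|A|%:R <= t, s <= #|U|%:R & guard g j' (nb g A U) (U :\: nb g A U)]
  else true.

(** The last layer is not guarded, so [j] steps of [reached] control [j.+1] steps of [guard]. *)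
Lemma guardT g j A U : (reached g j A U)%:R <= t ->
  s + (reached g j A U)%:R <= #|U|%:R + #|A|%:R -> guard g j.+1 A U.
Proof.
elim: j A U => [|j IH] A U.
  by rewrite /= => -> h; rewrite andbT /=; lra.
rewrite [reached _ _ _ _]/= => h1 h2.
have A0 : 0 <= #|A|%:R :> R by [].
have r0 : 0 <= (reached g j (nb g A U) (U :\: nb g A U))%:R :> R by [].
have Ue : #|U|%:R = #|nb g A U|%:R + #|U :\: nb g A U|%:R :> R by rewrite -natrD card_nb_diff.
rewrite natrD in h1 h2; rewrite -/(guard g j.+2 A U) /guard -/guard; apply/and3P; split; [lra|lra|].
by apply: IH; lra.
Qed.

(** Guaranteed growth factor: a layer of size a <= t hits each of at least s unexplored vertices
    with probability at least pa/(1 + pt). *)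
Let D' := s * p / (1 + p * t).

(** Counterpart of [growth] for negative exponents: scale [z] on the next layer gives at worst scale
    [decay z] on the current one. *)
Definition decay (z : R) := (z + 1) / D'.

Lemma guard_expR_le j A U y : 0 < y -> 0 <= t -> 0 < s -> 0 < p -> [disjoint A & U] ->
  Ex p (fun w => (guard (symg w) j A U)%:R * expR (- (#|layer (symg w) j A U|%:R / y)))
  <= expR (- (#|A|%:R / iter j decay y)).
Proof.
move=> y0 t0 s0 pp0.
have D'0 : 0 < D' by rewrite divr_gt0 ?mulr_gt0 // ltr_wpDr // mulr_ge0.
elim: j A U => [|j IH] A U AU; first by rewrite /= Ex_cst mul1r.
have [h|h] := boolP ((#|A|%:R <= t) && (s <= #|U|%:R)); last first.
  rewrite (@eq_Ex _ _ _ _ (fun=> 0)) ?Ex_cst ?expR_ge0 // => w.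
  by rewrite /= andbA (negPf h) mul0r.
case/andP: (h) => At sU; rewrite iterS.
set z := iter j decay y; have z0 : 0 < z.
  by rewrite /z; elim: (j) => //= i zi; rewrite divr_gt0 // ltr_wpDr.
pose K N w := (guard (symg w) j N (U :\: N))%:R * expR (- (#|layer (symg w) j N (U :\: N)|%:R / y)).
rewrite (@eq_Ex _ _ _ _ (fun w => K (nb (symg w) A U) w)) => [|w]; last first.
  by rewrite /= At sU.
rewrite (@Ex_nb A U K) => [|N NU w w' ww']; last first.
  have ag := nb_split_dep AU NU ww'; rewrite /K; have [-> _ _] := exploration_agree j ag.
  congr (_%:R * _); congr (nat_of_bool _).
  elim: (j) (N) (U :\: N) ag => //= i IHi B C ag.
  have -> : nb (symg w) B C = nb (symg w') B C.
    by apply: nb_dep => e eBC; apply: ag; apply: btw_sub eBC => //; exact: subsetUl.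
  congr [&& _, _ & _]; apply: IHi => e eB; apply: ag; apply: btw_sub eB; last exact: subsetDl.
  by rewrite nb_union subsetUr.
apply: (@le_trans _ _ (Ex p (fun w => expR (#|nb (symg w) A U|%:R * - z^-1)))).
  by apply: le_Ex => // w; rewrite mulrN; apply: IH; exact: nb_disjoint.
rewrite nb_expR //.
have zi0 : 0 < z^-1 by rewrite invr_gt0.
have c1 := one_sub_expRN_ge (ltW zi0).
have c2 := one_sub_expRN_ge (mulr_ge0 p0 (ler0n R #|A|)).
have c3 : (1 - p) ^+ #|A| <= expR (- (p * #|A|%:R)).
  by rewrite mulrC -mulrN; apply: one_add_pow_le; rewrite subr_ge0.
have e0 := expR_ge0 (- z^-1); have q0 := powp_ge0 #|A|.
have q1 : 1 - (1 - p) ^+ #|A| <= 1 by rewrite gerBl exprn_ge0 // subr_ge0.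
set q := 1 - _ in q0 q1 *; set c := expR _ in c1 e0 *.
have zc : z^-1 / (1 + z^-1) = (z + 1)^-1.
  by field; rewrite !gt_eqF // addr_gt0.
rewrite zc in c1.
have pt : 0 < 1 + p * t by rewrite ltr_wpDr // mulr_ge0.
have pA : 0 < 1 + p * #|A|%:R by rewrite ltr_wpDr // mulr_ge0.
have pa : p * #|A|%:R / (1 + p * t) <= q.
  apply: le_trans (_ : p * #|A|%:R / (1 + p * #|A|%:R) <= q); last by rewrite /q; lra.
  by rewrite ler_wpM2l ?mulr_ge0 // lef_pV2 ?posrE // lerD2l ler_wpM2l.
have -> : - (#|A|%:R / decay z) = - (s * (p * #|A|%:R / (1 + p * t) * (z + 1)^-1)).
  by rewrite /decay /D'; field; rewrite !gt_eqF // addr_gt0.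
apply: le_trans (one_add_pow_le _ _) _.
  by rewrite mulrBr mulr1 addrCA addr_ge0 ?mulr_ge0 // subr_ge0.
rewrite ler_expR -[q * _]opprK mulrN lerN2 -mulrN opprB.
apply: ler_pM => //; first exact: ltW.
  by rewrite !mulr_ge0 ?invr_ge0 // addr_ge0 ?mulr_ge0 // ltW.
apply: ler_pM => //; first by rewrite mulr_ge0 ?mulr_ge0 ?invr_ge0 ?addr_ge0 ?mulr_ge0.
by rewrite invr_ge0 addr_ge0 // ltW.
Qed.

End Exploration.

(** * Separating vertices are numerous *)

Section Witnesses.
Variables (R : realType) (n : nat) (p : R).
Hypotheses (p0 : 0 <= p) (p1 : p <= 1).
Implicit Types (w g : graph n) (u v : 'I_n) (A U L X Y : {set 'I_n}).

(** Markov's inequality for the exponential moment. *)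
Lemma reached_tail j A U (y c : R) : 0 < y -> [disjoint A & U] ->
  Ex p (fun w => (c < (reached (symg w) j A U)%:R)%R%:R)
  <= expR (#|A|%:R / y - c / iter j (growth n p) y).
Proof.
move=> y0 AU; set Y := iter _ _ _.
have Y0 : 0 < Y by apply: lt_le_trans (iter_growth_ge n p0 j y0).
rewrite expRD mulrC; apply: le_trans (ler_wpM2l (expR_ge0 _) (reached_expR_le p0 p1 j y0 AU)).
rewrite -ExZ; apply: le_Ex => // w; rewrite -expRD addrC -mulNr -mulrDl.
case: ltP => [lt_c|_] /=; last exact: expR_ge0.
by rewrite -[leLHS]expR0 ler_expR divr_ge0 ?subr_ge0 ?(ltW lt_c) ?(ltW Y0).
Qed.

(** Each vertex of [X] stays outside [nb] independently with probability (1 - p)^|L|, and then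
    contributes exp(-rho). *)
Lemma Ex_avoid_nb L X (rho : R) : [disjoint L & X] ->
  Ex p (fun w => expR (- (rho * #|X :\: nb (symg w) L X|%:R)))
  = (1 - (1 - p) ^+ #|L| * (1 - expR (- rho))) ^+ #|X|.
Proof.
move=> LX; have e w : expR (- (rho * #|X :\: nb (symg w) L X|%:R))
    = expR (- rho) ^+ #|X| * expR (#|nb (symg w) L X|%:R * rho).
  have := card_nb_diff (symg w) L X; set a := #|nb _ _ _|; set b := #|_ :\: _| => <-.
  rewrite -expRM_natl -expRD natrD; congr expR; ring.
rewrite (eq_Ex _ e) ExZ nb_expR // -exprMn; congr (_ ^+ _).
by have := expRxMexpNx_1 rho; set a := expR rho; set b := expR _ => ab; ring: ab.
Qed.

(* The vertices at distance [k] from [u] in what remains when the ball of radius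
   [k] around [v] in [G - u] is removed, and not adjacent to that ball: as
   landmarks they all separate the non-adjacent [u] and [v]. *)
Definition witnesses g k u v : {set 'I_n} :=
  let Y := rest g k [set v] (~: [set u; v]) in
  layer g k [set u] Y :\: nb g (layer g k [set v] (~: [set u; v])) Y.

(** * Estimates for searches of radius [j.+1] and landmark density [rho] *)

Section Estimate.
Variables (j : nat) (rho N l D : R).
Hypotheses (Nn : N = n%:R) (lN : l = ln N) (DE : D = N * p + 1).
Hypotheses (l0 : 2^-1 <= l) (np : 2000 * l <= N * p).
Hypotheses (jlo : 16 * D ^+ j.+2 <= N) (jhi : N < 16 * D ^+ j.+3).
Hypotheses (rlo : 256 * D ^+ 2 * l <= rho * N) (rho1 : rho <= 1).

Ltac weak_lra := move: (p0) (p1) (l0) (np) (DE); lra.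

Let N0 : 0 < N.
Proof.
rewrite lt_neqAle eq_sym {2}Nn ler0n andbT; apply/eqP => Ne.
by move: np; rewrite Ne mul0r; weak_lra.
Qed.

Let NE : N = expR l. Proof. by rewrite lN lnK // posrE. Qed.

Let D0 : 1001 <= D. Proof. by weak_lra. Qed.

Ltac regime_lra := move: (p0) (p1) (l0) (np) (DE) (N0) (D0) (rho1) (jlo) (jhi); lra.
Ltac regime_nra := move: (p0) (p1) (l0) (np) (DE) (N0) (D0) (rho1) (jlo) (jhi); nra.

Let Dj0 i : 0 < D ^+ i. Proof. by rewrite exprn_gt0 //; regime_lra. Qed.

Let pDk : 16 * (p * D ^+ j.+1) <= 1.
Proof.
have h : N * p * D ^+ j.+1 <= D ^+ j.+2.
  by rewrite [leRHS]exprS ler_wpM2r ?ltW //; regime_lra.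
rewrite -(ler_pM2l N0); regime_lra.
Qed.

Let pp0 : 0 < p.
Proof. by rewrite -(ltr_pM2l N0) mulr0; regime_lra. Qed.

(** At starting scale 1/l the single source costs exp(l) = N, while the final scale Y <= 2 D^i / l
    gains exp(-4 D^i / Y) <= N^-2. *)
Lemma reached_whp i A U : #|A| = 1%N -> [disjoint A & U] ->
  Ex p (fun w => (4 * D ^+ i < (reached (symg w) i A U)%:R)%R%:R) <= N^-1.
Proof.
move=> A1 AU; have li0 : 0 < l^-1 by rewrite invr_gt0; regime_lra.
apply: le_trans (reached_tail i _ li0 AU) _.
have Yle : iter i (growth n p) l^-1 <= 2 * D ^+ i / l.
  have np0 : 0 < N * p by regime_lra.
  (* The fixed point of [growth] is -1/(Np), so adding 1/(Np) makes the iteration geometric. *)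
  have h : iter i (growth n p) l^-1 + (N * p)^-1 = D ^+ i * (l^-1 + (N * p)^-1).
    elim: i {AU} => [|i IH]; first by rewrite expr0 mul1r.
    rewrite iterS exprS -mulrA -IH /growth -Nn -DE.
    rewrite DE; field; rewrite !gt_eqF //; regime_lra.
  have h2 : (N * p)^-1 <= l^-1 by rewrite lef_pV2 ?posrE; regime_lra.
  have h3 : 0 < (N * p)^-1 by rewrite invr_gt0.
  have := ler_wpM2l (ltW (Dj0 i)) h2; regime_nra.
have Y0 : 0 < iter i (growth n p) l^-1 by apply: lt_le_trans (iter_growth_ge n p0 i li0).
rewrite A1 mul1r invrK NE -expRN ler_expR.
suff : 2 * l <= 4 * D ^+ i / iter i (growth n p) l^-1 by regime_lra.
rewrite ler_pdivlMr //.
apply: le_trans (ler_wpM2l _ Yle) _; first by regime_lra.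
by rewrite le_eqVlt; apply/orP; left; apply/eqP; field; rewrite gt_eqF //; regime_lra.
Qed.

(** [t] caps the layers around u, [s] bounds from below what both searches leave unexplored, and
    4/rho is the scale supplied by [avoid_base_le]. *)
Local Notation t := (4 * D ^+ j).
Local Notation s := (N - 9 * D ^+ j.+1).
Local Notation y := (4 / rho).

Let rho0 : 0 < rho.
Proof.
rewrite -(ltr_pM2r N0) mul0r; apply: lt_le_trans rlo.
by rewrite !mulr_gt0 ?exprn_gt0 //; regime_lra.
Qed.

Let s0 : 0 < s.
Proof.
have : D ^+ j.+1 <= D ^+ j.+2 by rewrite [leRHS]exprS ler_peMl ?ltW //; regime_lra.
by have := Dj0 j.+1; regime_lra.
Qed.

(** By [pDk], the vertices already removed lower Np = D - 1 by at most 9/16, and collisions by at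
    most another 1/4. *)
Let D'ge : D - 2 <= s * p / (1 + p * t).
Proof.
have pt0 : 0 < 1 + p * t by rewrite ltr_wpDr // !mulr_ge0 // ltW.
rewrite ler_pdivlMr //.
have e : D ^+ j.+1 = D * D ^+ j by rewrite exprS.
have h := pDk; rewrite e in h *.
have : 0 <= p * D ^+ j by rewrite mulr_ge0 // ltW.
rewrite DE in h *; regime_nra.
Qed.

Let decay_le : iter j.+1 (decay p t s) y <= l^-1.
Proof.
have y0 : 0 < y by rewrite divr_gt0.
(* The added 1's form a geometric series of sum at most 1/(D - 3). *)
have h i : 0 <= iter i (decay p t s) y <= y / (D - 2) ^+ i + (D - 3)^-1.
  elim: i => [|i /andP[h1 h2]]; rewrite ?iterS.
    by rewrite expr0 divr1 ltW //= lerDl invr_ge0; regime_lra.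
  set z := iter _ _ _ in h1 h2 *; rewrite /decay.
  have D'0 : 0 < s * p / (1 + p * t) by apply: lt_le_trans D'ge; regime_lra.
  rewrite divr_ge0 ?addr_ge0 ?(ltW D'0) //=.
  apply: (@le_trans _ _ ((z + 1) / (D - 2))).
    by rewrite ler_wpM2l ?addr_ge0 // lef_pV2 ?posrE //; regime_lra.
  rewrite ler_pdivrMr; last by regime_lra.
  have -> : (y / (D - 2) ^+ i.+1 + (D - 3)^-1) * (D - 2) = y / (D - 2) ^+ i + (D - 3)^-1 + 1.
    rewrite exprS; field; rewrite expf_eq0 negb_and; apply/and3P; split; rewrite ?gt_eqF ?orbT //; regime_lra.
  by regime_lra.
have /andP[_ /le_trans] := h j.+1; apply.
have k2l : j.+1%:R * 2^-1 <= l.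
  rewrite -ler_expR -NE.
  have e2 := expR_half_le2 R.
  rewrite expRM_natl; apply: le_trans (_ : D ^+ j.+1 <= N).
    by rewrite lerXn2r ?nnegrE ?expR_ge0 //; regime_lra.
  by have := s0; have := Dj0 j.+1; regime_lra.
(* (1 - 2/D)^(j+1) >= 1 - 2(j+1)/D >= 1/2, since j + 1 <= 2l is small against D. *)
have Dhalf : D ^+ j.+1 / 2 <= (D - 2) ^+ j.+1.
  have -> : D - 2 = D * (1 - 2 / D) by field; rewrite gt_eqF //; regime_lra.
  rewrite exprMn; apply: ler_wpM2l; first exact: ltW.
  apply: le_trans (bernoulli_ineq j.+1 _ _); last 2 first.
  - by rewrite divr_ge0 //; regime_lra.
  - by rewrite ler_pdivrMr; regime_lra.
  have : j.+1%:R * (2 / D) <= 2^-1; last by regime_lra.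
  by rewrite mulrA ler_pdivrMr; regime_lra.
have a1 : (D - 3)^-1 <= (2 * l)^-1 by rewrite lef_pV2 ?posrE; regime_lra.
(* The constant 256 enters here: rho N >= 256 D^2 l and N < 16 D^(j+3) give rho D^(j+1) >= 16 l. *)
have a2 : y / (D - 2) ^+ j.+1 <= (2 * l)^-1.
  have b1 : y / (D - 2) ^+ j.+1 <= y / (D ^+ j.+1 / 2).
    have q0 : 0 < (D - 2) ^+ j.+1 by rewrite exprn_gt0 //; regime_lra.
    have q1 : 0 < D ^+ j.+1 / 2 by rewrite divr_gt0.
    by rewrite ler_wpM2l ?(ltW y0) // lef_pV2.
  apply: le_trans b1 _.
  have -> : y / (D ^+ j.+1 / 2) = 8 / (rho * D ^+ j.+1).
    by field; rewrite !gt_eqF.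
  rewrite ler_pdivrMr ?mulr_gt0 // mulrC ler_pdivlMr; last by regime_lra.
  rewrite -(ler_pM2r N0).
  have -> : rho * D ^+ j.+1 * N = rho * N * D ^+ j.+1 by ring.
  apply: le_trans (ler_wpM2r (ltW (Dj0 j.+1)) rlo).
  have -> : 256 * D ^+ 2 * l * D ^+ j.+1 = 256 * l * D ^+ j.+3.
    by rewrite (exprD _ 2 j.+1 : D ^+ j.+3 = _); ring.
  have : l * N <= l * (16 * D ^+ j.+3) by apply: ler_wpM2l; [regime_lra | exact: ltW].
  regime_lra.
rewrite invfM in a1 a2; regime_lra.
Qed.

(** Either the search around u reaches too many vertices, which has probability at most 1/N, or the
    guard holds and the Laplace transform is at most exp(-l) = 1/N. *)
Lemma layer_whp u Y : u \notin Y -> N - 1 - 4 * D ^+ j.+1 <= #|Y|%:R ->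
  Ex p (fun w => expR (- (#|layer (symg w) j.+1 [set u] Y|%:R / y))) <= 2 / N.
Proof.
move=> uY Ycard; have uYd : [disjoint [set u] & Y] by rewrite disjoints1.
have t0 : 0 <= t by rewrite mulr_ge0 // ltW.
have y0 : 0 < y by rewrite divr_gt0.
pose bad w : R := (4 * D ^+ j < (reached (symg w) j [set u] Y)%:R)%R%:R.
pose good w := (guard t s (symg w) j.+1 [set u] Y)%:R *
  expR (- (#|layer (symg w) j.+1 [set u] Y|%:R / y)).
apply: (@le_trans _ _ (Ex p (fun w => bad w + good w))).
  apply: le_Ex => // w; rewrite /bad /good; case: ltP => h.
    by rewrite -[leLHS]addr0 lerD ?mulr_ge0 ?expR_ge0 // expR_le1 oppr_le0 divr_ge0 // ltW.
  rewrite guardT ?mul1r ?add0r // cards1.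
  have : D ^+ j <= D ^+ j.+1 by rewrite [leRHS]exprS ler_peMl ?ltW //; regime_lra.
  by have := Dj0 j.+1; regime_lra.
rewrite ExD mulrDl mul1r; apply: lerD; first by apply: reached_whp; rewrite ?cards1.
apply: le_trans (guard_expR_le p0 p1 _ y0 t0 s0 pp0 uYd) _.
have -> : N^-1 = expR (- l) by rewrite expRN -NE.
rewrite cards1 ler_expR lerN2 div1r.
have D'0 : 0 < s * p / (1 + p * t) by apply: lt_le_trans D'ge; regime_lra.
have Z0 i : 0 < iter i (decay p t s) y.
  elim: i => [|i hi]; first exact: y0.
  by rewrite iterS; apply: divr_gt0 => //; apply: ltr_wpDr.
have l00 : 0 < l by regime_lra.
by rewrite -[leLHS]invrK lef_pV2 ?posrE ?invr_gt0 //; exact: decay_le.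
Qed.

(** A vertex outside [L] has no edge to [L] with probability at least 3/4, and 1 - exp(-rho) >=
    rho/2 as rho <= 1; the product exceeds rho/4. *)
Lemma avoid_base_le L : #|L|%:R <= 4 * D ^+ j.+1 ->
  1 - (1 - p) ^+ #|L| * (1 - expR (- rho)) <= expR (- y^-1).
Proof.
move=> Lc; apply: le_trans (expR_ge1Dx _); rewrite lerD2l lerN2.
have r34 : 3 / 4 <= (1 - p) ^+ #|L|.
  apply: le_trans (bernoulli_ineq _ p0 p1).
  have : #|L|%:R * p <= 4 * D ^+ j.+1 * p by rewrite ler_wpM2r.
  by have := pDk; regime_lra.
have e : rho / 2 <= 1 - expR (- rho).
  apply: le_trans (one_sub_expRN_ge (ltW rho0)); rewrite ler_wpM2l ?(ltW rho0) //.
  by rewrite lef_pV2 ?posrE //; have := rho0; regime_lra.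
rewrite invf_div; apply: le_trans (_ : 3 / 4 * (rho / 2) <= _); first by have := rho0; regime_lra.
by apply: ler_pM => //; have := rho0; regime_lra.
Qed.

(** The search from u reads no pair between [L] and [Y], so those edges are averaged afterwards,
    with the layer fixed. *)
Lemma source_le u L Y : u \notin L :|: Y -> [disjoint L & Y] ->
  #|L|%:R <= 4 * D ^+ j.+1 -> N - 1 - 4 * D ^+ j.+1 <= #|Y|%:R ->
  Ex p (fun w => expR (- (rho * #|layer (symg w) j.+1 [set u] Y :\: nb (symg w) L Y|%:R)))
  <= 2 / N.
Proof.
rewrite inE negb_or => /andP[uL uY] LY Lc Yc; apply: le_trans (layer_whp uY Yc).
pose H w w' := expR (- (rho * #|layer (symg w) j.+1 [set u] Y :\: nb (symg w') L Y|%:R)).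
rewrite (@Ex_split _ _ _ (btw ([set u] :|: Y) Y) H); last first.
  move=> w w'; rewrite /H.
  have [e|-> _ _] := @exploration_agree _ w (mix (btw ([set u] :|: Y) Y) w w') j.+1 [set u] Y.
    by move=> eP; rewrite mix_in.
  congr (expR (- (_ * #|_ :\: _|%:R))); apply: nb_dep => e eLY; rewrite mix_notin //.
  rewrite inE; apply: contraTN eLY; apply: btw_disj => //.
  by rewrite -setI_eq0 setIUr (disjoint_setI0 LY) setU0 setI_eq0 disjoint_sym disjoints1.
apply: le_Ex => // w; rewrite /H; set X := layer _ _ _ _.
have XY : X \subset Y by exact: layerS_subset.
have LX : [disjoint L & X] by apply: disjointWr LY.
have XD w' : X :\: nb (symg w') L Y = X :\: nb (symg w') L X.
  apply/setP=> x; rewrite !inE; case xX: (x \in X); rewrite ?andbF //=.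
  by rewrite (subsetP XY _ xX).
under eq_Ex => w' do rewrite XD.
rewrite Ex_avoid_nb // -[in leRHS]mulrN expRM_natl; apply: lerXn2r; rewrite ?nnegrE ?expR_ge0 //.
  rewrite subr_ge0 mulr_ile1 ?exprn_ge0 ?exprn_ile1 ?subr_ge0 ?gerBl ?expR_ge0 //.
  by rewrite expR_le1 oppr_le0 ltW.
exact: avoid_base_le.
Qed.

(** The search around v takes place in G - u and leaves all pairs at u fresh; [source_le] then
    applies to its outcome. *)
Lemma witnesses_expR_le u v : u != v ->
  Ex p (fun w => expR (- (rho * #|witnesses (symg w) j.+1 u v|%:R))) <= 3 / N.
Proof.
move=> uv; set A := [set v]; set U := ~: [set u; v].
have AU : [disjoint A & U] by rewrite disjoints1 !inE eqxx orbT.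
have AUE : A :|: U = ~: [set u].
  by apply/setP=> x; rewrite !inE negb_or; case: (eqVneq x v) => [->|_]; rewrite ?andbT // eq_sym uv.
pose bad w : R := (4 * D ^+ j.+1 < (reached (symg w) j.+1 A U)%:R)%R%:R.
(* The indicator of good sizes makes the bound valid for all [L] and [Y], as [exploration_le]
   demands. *)
pose F L Y w := ((#|L|%:R <= 4 * D ^+ j.+1) && (N - 1 - 4 * D ^+ j.+1 <= #|Y|%:R))%R%:R *
  expR (- (rho * #|layer (symg w) j.+1 [set u] Y :\: nb (symg w) L Y|%:R)).
apply: (@le_trans _ _ (Ex p (fun w => bad w +
    F (layer (symg w) j.+1 A U) (rest (symg w) j.+1 A U) w))).
  apply: le_Ex => // w; rewrite /bad /F /witnesses -/A -/U; case: ltP => h.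
    rewrite -[leLHS]addr0 lerD ?mulr_ge0 ?expR_ge0 // expR_le1 oppr_le0.
    by rewrite mulr_ge0 // ltW.
  rewrite add0r.
  have /eqP := reached_rest (symg w) j.+1 A U.
  rewrite -[X in _ == X](_ : #|A :|: U| = _)%N; last by rewrite cardsU (disjoint_setI0 AU) cards0 subn0.
  rewrite AUE cardsC1 card_ord -(eqr_nat R) natrD => /eqP he.
  have nn : n.-1%:R = N - 1 :> R.
    have n0 : (0 < n)%N by rewrite -(ltr_nat R) -Nn.
    by rewrite Nn -{2}(prednK n0) -natr1 addrK.
  have := layer_le_reached (symg w) j.+1 A U; rewrite -(ler_nat R) => hl.
  rewrite (_ : (_ <= _) && _) ?mul1r //; apply/andP; split; first exact: le_trans h.
  by rewrite -nn -he; regime_lra.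
rewrite ExD.
have -> : 3 / N = N^-1 + 2 / N by rewrite -[X in X + _]mul1r -mulrDl; congr (_ / _); regime_lra.
apply: lerD; first by apply: reached_whp; rewrite ?cards1.
apply: (@exploration_le _ _ _ p0 p1 j.+1 A U (btw [set u] setT) F (2 / N) AU).
- move=> e; rewrite AUE [e \in predC _]inE btwE /btw !inE.
  by case: (e.1 == u); case: (e.2 == u).
- move=> L Y w w' ww'.
  have [e|lE _ _] := @exploration_agree _ w w' j.+1 [set u] Y.
    rewrite btwE !inE => eP; apply: ww'; move: eP; rewrite inE /= !btwE !inE.
    by case: (e.1 \in Y); case: (e.2 \in Y); case: (e.1 == u); case: (e.2 == u); rewrite ?orbT.
  have nE : nb (symg w) L Y = nb (symg w') L Y.
    by apply: nb_dep => e eP; apply: ww'; rewrite inE (btw_sub _ _ eP) //; exact: subsetUl.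
  by rewrite /F lE nE.
move=> L Y; rewrite AUE => LYs LY; rewrite /F.
case: andP => [[Lc Yc]|_] /=; last first.
  by under eq_Ex do rewrite mul0r; rewrite Ex_cst divr_ge0 // ltW.
under eq_Ex do rewrite mul1r.
apply: source_le => //; apply/negP => /(subsetP LYs); by rewrite !inE eqxx.
Qed.

End Estimate.
End Witnesses.

(** * Distances *)

Section Separation.
Variable n : nat.
Implicit Types (g : graph n) (u v x y z : 'I_n) (A U : {set 'I_n}).

(* Since [dist] never exceeds [n], an infinite answer counts as separating only
   when the other distance leaves room for a neighbour's distance. *)
Definition sep (a b : option nat) : bool :=
  match a, b with
  | Some i, Some j => (i.+1 < j) || (j.+1 < i)
  | Some i, None | None, Some i => i.+1 < n
  | None, None => false
  end%N.

Lemma dist_Some g u y a : dist g u y = Some a ->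
  y \in ball g u a /\ forall i, (i < a)%N -> y \notin ball g u i.
Proof.
rewrite /dist; case: ifP => // h [<-]; split=> [|i ia].
  have := nth_find 0%N (_ : has (fun k => y \in ball g u k) (iota 0 n)).
  by rewrite has_find size_iota h nth_iota // => ->.
have := before_find 0%N ia; rewrite nth_iota ?add0n => [->//|].
exact: ltn_trans ia h.
Qed.

Lemma dist_le g u y a : (a < n)%N -> y \in ball g u a -> exists2 b, dist g u y = Some b & (b <= a)%N.
Proof.
move=> an ya; exists (find (fun k => y \in ball g u k) (iota 0 n)); last first.
  rewrite leqNgt; apply/negP => h; have := before_find 0%N h.
  by rewrite nth_iota // add0n ya.
rewrite /dist -[X in (_ < X)%N](size_iota 0 n) -has_find ifT //.
by apply/hasP; exists a; rewrite // mem_iota add0n.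
Qed.

Lemma ball_step g u k x y : x \in ball g u k -> g (x, y) -> y \in ball g u k.+1.
Proof.
by move=> xk gxy; rewrite !inE; apply/orP; right; apply/existsP; exists x; rewrite xk.
Qed.

Lemma ball_mono g u i j : (i <= j)%N -> ball g u i \subset ball g u j.
Proof.
move=> /subnK <-; elim: (j - i)%N => //= k /subset_trans; apply; exact: subsetUl.
Qed.

Lemma ball_edge g u v k : g (u, v) -> ball g v k \subset ball g u k.+1.
Proof.
move=> guv; elim: k => [|k IH].
  by rewrite sub1set; apply: ball_step guv; rewrite inE.
apply/subsetP=> y; rewrite inE => /orP[/(subsetP IH)|].
  by apply/subsetP/ball_mono.
by rewrite inE => /existsP[x /andP[/(subsetP IH) xk gxy]]; exact: ball_step gxy.
Qed.

Lemma edge_not_sep g u v y : is_simple g -> g (u, v) -> ~~ sep (dist g u y) (dist g v y).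
Proof.
move=> gs guv; have gvu : g (v, u) by rewrite simpleC.
case du: (dist g u y) => [a|]; case dv: (dist g v y) => [b|] //=.
- have [ya amin] := dist_Some du; have [yb bmin] := dist_Some dv.
  rewrite negb_or; apply/andP; split; apply/negP => lt.
    by have := bmin _ lt; rewrite (subsetP (ball_edge a gvu)).
  by have := amin _ lt; rewrite (subsetP (ball_edge b guv)).
- have [ya _] := dist_Some du; apply/negP => an.
  by have [b] := dist_le an (subsetP (ball_edge a gvu) _ ya); rewrite dv.
have [yb _] := dist_Some dv; apply/negP => bn.
by have [a] := dist_le bn (subsetP (ball_edge b guv) _ yb); rewrite du.
Qed.

Lemma dist1 g u v : u != v -> (dist g u v == Some 1%N) = g (u, v).
Proof.
(* [dist] only tries radii below n, so radius 1 must be among them. *)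
move=> uv; have n1 : (1 < n)%N.
  case: n u v uv {g} => [|[|m]] u v //; first by case: u.
  by rewrite (ord1 u) (ord1 v).
have vu : (v == u) = false by rewrite eq_sym (negPf uv).
apply/eqP/idP => [/dist_Some[]|guv].
  by rewrite !inE vu /= => /existsP[x]; rewrite inE => /andP[/eqP->].
have [b db b1] : exists2 b, dist g u v = Some b & (b <= 1)%N.
  by apply: dist_le => //; apply: ball_step guv; rewrite inE.
case: b b1 db => [|[|]] // _ db.
by have [] := dist_Some db; rewrite inE vu.
Qed.

Lemma layer_ball g u i k A U : A \subset ball g u i -> layer g k A U \subset ball g u (i + k).
Proof.
elim: k i A U => [|k IH] i A U Ai; first by rewrite addn0.
rewrite addnS -addSn; apply: IH; apply/subsetP=> y; rewrite inE => /andP[_].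
by case/existsP=> x /andP[/(subsetP Ai) xi]; exact: ball_step.
Qed.

Lemma layerSr g k A U : layer g k.+1 A U = nb g (layer g k A U) (rest g k A U).
Proof. by elim: k A U => //= k IH A U; rewrite -IH. Qed.

Lemma restSr g k A U : rest g k.+1 A U = rest g k A U :\: nb g (layer g k A U) (rest g k A U).
Proof. by elim: k A U => //= k IH A U; rewrite -IH. Qed.

Lemma rest_antimono g i k A U : (i <= k)%N -> rest g k A U \subset rest g i A U.
Proof.
move=> /subnK <-; elim: (k - i)%N => // m IH.
by rewrite addSn restSr; apply: subset_trans IH; exact: subsetDl.
Qed.

Lemma rest_not_layer g i k A U y : [disjoint A & U] -> (i <= k)%N ->
  y \in rest g k A U -> y \notin layer g i A U.
Proof.
move=> AU ik /(subsetP (rest_antimono g A U ik)) yr; apply/negP => yl.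
by have /disjoint_setI0/setP/(_ y) := layer_rest_disjoint g i AU; rewrite !inE yl yr.
Qed.

Lemma layer_nbr g i A U x y : x \in layer g i A U -> g (x, y) -> y \in A :|: U ->
  exists2 i', (i' <= i.+1)%N & y \in layer g i' A U.
Proof.
elim: i A U => [|i IH] A U /= xl gxy.
  rewrite inE => /orP[yA|yU]; first by exists 0%N.
  by exists 1%N => //=; rewrite inE yU; apply/existsP; exists x; rewrite xl.
rewrite inE => /orP[yA|yU]; first by exists 0%N.
have [|i' ii' yl] := IH _ _ xl gxy; first by rewrite nb_union.
by exists i'.+1.
Qed.

(* A shortest path from [v] that visits [u] reaches [u] at distance at least two. *)
Lemma ball_cover g u v j y : u != v -> ~~ g (v, u) -> y \in ball g v j ->
  (exists2 i, (i <= j)%N & y \in layer g i [set v] (~: [set u; v])) \/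
  (exists2 i, (i.+2 <= j)%N & y \in ball g u i).
Proof.
move=> uv gvu; elim: j y => [|j IH] y yj; first by left; exists 0%N.
move: yj; rewrite inE => /orP[/IH[[i ij yi]|[i ij yi]]|].
- by left; exists i => //; exact: leqW.
- by right; exists i => //; exact: leqW.
rewrite inE => /existsP[x /andP[/IH[[i ij xi]|[i ij xi]] gxy]]; last first.
  by right; exists i.+1 => //; exact: ball_step gxy.
have [yu|yu] := eqVneq y u.
  right; exists 0%N; last by rewrite inE yu.
  case: i ij xi => [_|i ij _]; last by rewrite !ltnS; exact: leq_ltn_trans ij.
  by rewrite /= inE => /eqP xv; rewrite -xv -yu gxy in gvu.
have [|i' ii' yi'] := layer_nbr xi gxy.
  by rewrite !inE negb_or yu /=; case: eqVneq.
by left; exists i' => //; apply: leq_trans ii' _.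
Qed.

(** If d(v, y) <= d(u, y) + 1 <= k + 2, a shortest path from v avoiding u would put [y] in one of
    the first layers around v, and one through u would be too long. *)
Lemma witness_sep g k u v y : is_simple g -> u != v -> ~~ g (u, v) -> (k.+2 < n)%N ->
  y \in witnesses g k.+1 u v -> sep (dist g u y) (dist g v y).
Proof.
move=> gs uv guv kn; rewrite /witnesses.
set L := layer g k.+1 [set v] _; set Y := rest _ _ _ _.
rewrite inE => /andP[ynb yl].
have AU : [disjoint [set v] & ~: [set u; v]] by rewrite disjoints1 !inE eqxx orbT.
have yY : y \in Y by apply: (subsetP (layerS_subset g k [set u] Y)).
have nolayer i : (i <= k.+2)%N -> y \notin layer g i [set v] (~: [set u; v]).
  rewrite leq_eqVlt => /orP[/eqP->|]; first by rewrite layerSr.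
  by rewrite ltnS => ik; exact: rest_not_layer AU ik yY.
have yu : y \in ball g u k.+1.
  by have := @layer_ball g u 0 k.+1 [set u] Y (subxx _); rewrite add0n => /subsetP; apply.
have [a da ak] := dist_le (ltnW kn) yu; rewrite da.
have [_ amin] := dist_Some da.
case dv: (dist g v y) => [b|] /=; last by apply: leq_ltn_trans kn.
apply/orP; left; rewrite ltnNge; apply/negP => ba.
have [yb _] := dist_Some dv.
have gvu : ~~ g (v, u) by rewrite simpleC.
have [[i ib yi]|[i ib yi]] := ball_cover uv gvu yb.
  by move: yi; apply/negP/nolayer; apply: leq_trans ib (leq_trans ba _).
by move: yi; apply/negP/amin; rewrite -ltnS; exact: leq_trans ib ba.
Qed.

End Separation.

(** * The algorithm and its expected cost *)

Section Algorithm.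
Variable n : nat.
Implicit Types (g : graph n) (u v x y z : 'I_n) (e : 'I_n * 'I_n) (l : seq ('I_n * 'I_n)) (s : seq 'I_n).

(** A batch of non-adaptive queries in continuation-passing style. *)
Fixpoint ask l (cont : seq (option nat) -> qtree n) : qtree n :=
  if l is e :: l' then Query e.1 e.2 (fun a => ask l' (fun r => cont (a :: r)))
  else cont [::].

Definition answers g l := [seq dist g e.1 e.2 | e <- l].

Lemma run_output_ask g l cont :
  run_output (ask l cont) g = run_output (cont (answers g l)) g.
Proof. by elim: l cont => //= e l IH cont; rewrite IH. Qed.

Lemma run_cost_ask g l cont :
  run_cost (ask l cont) g = (size l + run_cost (cont (answers g l)) g)%N.
Proof. by elim: l cont => //= e l IH cont; rewrite IH. Qed.

Definition lookup l (r : seq (option nat)) e : option nat := nth None r (index e l).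

Lemma lookup_answers g l e : e \in l -> lookup l (answers g l) e = dist g e.1 e.2.
Proof.
by move=> el; rewrite /lookup (nth_map e) ?index_mem // nth_index.
Qed.

Definition landmark_pairs s := [seq (y, z) | y <- enum 'I_n, z <- s].

Definition candidates s r :=
  [seq e <- enum (vpairs n) | all (fun z =>
     ~~ sep n (lookup (landmark_pairs s) r (e.1, z)) (lookup (landmark_pairs s) r (e.2, z))) s].

Definition decode l r : graph n := symg [ffun e => (e \in l) && (lookup l r e == Some 1%N)].

Definition landmark_tree s : qtree n :=
  ask (landmark_pairs s) (fun r =>
    let l := candidates s r in ask l (fun r' => Output (decode l r'))).

Definition unsep g s e := all (fun z => ~~ sep n (dist g e.1 z) (dist g e.2 z)) s.

Lemma candidates_answers g s :
  candidates s (answers g (landmark_pairs s)) = [seq e <- enum (vpairs n) | unsep g s e].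
Proof.
apply: eq_filter => e; apply: eq_in_all => z zs.
by rewrite !lookup_answers ?allpairs_f ?mem_enum.
Qed.

(** A discarded pair is separated by a landmark, hence no edge; a pair that is kept is an edge
    exactly when its distance is 1. *)
Lemma landmark_tree_reconstructs s : reconstructs (landmark_tree s).
Proof.
move=> g gs; rewrite /landmark_tree run_output_ask /= candidates_answers run_output_ask /=.
apply: symg_id => // e; rewrite inE => eV; rewrite ffunE mem_filter mem_enum inE eV andbT.
have ne : e.1 != e.2 by apply: contraTneq eV => ->; rewrite ltnn.
case: (boolP (unsep g s e)) => [eu|/allPn[z zs]] /=; last first.
  by case: e ne {eV} => u v /= uv; rewrite negbK; case guv: (g (u, v)) => //; rewrite (negPf (edge_not_sep _ gs guv)).
by rewrite lookup_answers ?dist1 -?surjective_pairing // mem_filter eu mem_enum inE.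
Qed.

Lemma landmark_tree_cost g s :
  run_cost (landmark_tree s) g = (n * size s + \sum_(e in vpairs n) unsep g s e)%N.
Proof.
rewrite /landmark_tree run_cost_ask /= candidates_answers run_cost_ask /= addn0.
rewrite size_allpairs size_enum_ord; congr (_ + _)%N.
by rewrite size_filter -sum1_count big_enum_cond /= big_mkcondr; apply: eq_bigr => e _; case: unsep.
Qed.

End Algorithm.

(** * Cost averaged over random landmarks *)

Section ExpectedCost.
Variables (R : realType) (n : nat) (p : R) (m : nat).
Hypotheses (p0 : 0 <= p) (p1 : p <= 1).

Definition seed := {ffun 'I_m -> 'I_n}.
Definition weight (_ : seed) : R := #|{: seed}|%:R^-1.
Definition algo (s : seed) : qtree n := landmark_tree (codom s).

Lemma weight_ge0 s : 0 <= weight s. Proof. by rewrite invr_ge0. Qed.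

(** For n = 0 a seed exists only when m = 0. *)
Lemma sum_weight : (0 < n)%N || (m == 0)%N -> \sum_s weight s = 1.
Proof.
move=> nm; rewrite sumr_const -[LHS]mulr_natr mulVf // card_ffun !card_ord pnatr_eq0.
by rewrite expn_eq0 negb_and -lt0n; case: m nm => // k; rewrite orbF => ->.
Qed.

Lemma expected_costE (s : seed) :
  expected_cost p (algo s)
  = (n * m)%:R + \sum_(e in vpairs n) Ex p (fun w => (unsep (symg w) (codom s) e)%:R).
Proof.
rewrite /expected_cost gnp_Ex; under eq_Ex => w.
  rewrite landmark_tree_cost size_codom card_ord natrD natr_sum; over.
by rewrite ExD Ex_cst Ex_sum.
Qed.

Lemma average_costE : (0 < n)%N || (m == 0)%N ->
  \sum_s weight s * expected_cost p (algo s) = (n * m)%:R +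
  \sum_(e in vpairs n) Ex p (fun w => \sum_s weight s * (unsep (symg w) (codom s) e)%:R).
Proof.
move=> nm; under eq_bigr => s do rewrite expected_costE mulrDr.
rewrite big_split /= -mulr_suml sum_weight // mul1r; congr (_ + _).
under eq_bigr do rewrite mulr_sumr.
rewrite exchange_big /=; apply: eq_bigr => e _.
rewrite Ex_sum; apply: eq_bigr => s _.
by rewrite ExZ.
Qed.

Lemma average_cost_trivial : (0 < n)%N || (m == 0)%N ->
  \sum_s weight s * expected_cost p (algo s) <= (n * m + #|vpairs n|)%:R.
Proof.
move=> nm; rewrite average_costE // natrD lerD2l -sum1_card natr_sum; apply: ler_sum => e _.
apply: Ex_le_cst => // w; rewrite -[leRHS](sum_weight nm); apply: ler_sum => s _.
by rewrite ler_piMr ?weight_ge0 // lern1 leq_b1.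
Qed.

(* [m] uniform samples all miss [W] with probability [(1 - #|W| / n) ^ m]. *)
Lemma miss_prob (W : {set 'I_n}) : (0 < n)%N ->
  \sum_s weight s * [forall i, s i \notin W]%:R <= expR (- (m%:R / n%:R * #|W|%:R)).
Proof.
move=> n0; have nR : 0 < n%:R :> R by rewrite ltr0n.
have -> : \sum_s weight s * [forall i, s i \notin W]%:R = (1 - #|W|%:R / n%:R) ^+ m.
  rewrite /weight -mulr_sumr -natr_sum.
  have -> : (\sum_(s : seed) [forall i, s i \notin W] = #|~: W| ^ m)%N.
    rewrite -[m in RHS]card_ord -card_ffun_on -sum1_card [RHS]big_mkcond /=.
    apply: eq_bigr => s _; congr nat_of_bool; apply/forallP/ffun_onP => h i;
      by have := h i; rewrite inE.
  rewrite card_ffun !card_ord !natrX -exprVn -exprMn; congr (_ ^+ _).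
  have -> : #|~: W|%:R = n%:R - #|W|%:R :> R.
    by rewrite -[in X in X - _](card_ord n) -(cardsC W) natrD addrAC subrr add0r.
  by field; rewrite gt_eqF.
have W1 : #|W|%:R / n%:R <= 1 :> R.
  by rewrite ler_pdivrMr // mul1r ler_nat -[leqRHS]card_ord max_card.
apply: le_trans (one_add_pow_le _ _) _; first by rewrite subr_ge0.
by rewrite mulrN mulrA mulrAC.
Qed.

(** A pair is queried in the second phase only if it is an edge, which contributes p, or if all
    landmarks miss its witnesses, which contributes c. *)
Lemma average_cost_le k (c : R) : (0 < n)%N -> (k.+2 < n)%N ->
  (forall u v : 'I_n, u != v ->
     Ex p (fun w => expR (- (m%:R / n%:R * #|witnesses (symg w) k.+1 u v|%:R))) <= c) ->
  \sum_s weight s * expected_cost p (algo s) <= (n * m)%:R + #|vpairs n|%:R * (p + c).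
Proof.
move=> n0 kn hc; rewrite average_costE ?n0 // lerD2l.
rewrite mulr_natl -sumr_const; apply: ler_sum => -[u v] uvV.
have uv : u != v by apply: contraTneq uvV => ->; rewrite inE /= ltnn.
rewrite -[X in X + _](Ex_edge p uv); apply: le_trans (lerD (lexx _) (hc _ _ uv)).
rewrite -ExD; apply: le_Ex => // w.
case guv: (symg w (u, v)).
  apply: (@le_trans _ _ 1); last by rewrite lerDl expR_ge0.
  rewrite -[leRHS](sum_weight (_ : (0 < n)%N || (m == 0)%N)) ?n0 //; apply: ler_sum => s _.
  by rewrite ler_piMr ?weight_ge0 // lern1 leq_b1.
rewrite add0r; apply: le_trans (miss_prob _ n0); apply: ler_sum => s _.
rewrite ler_wpM2l ?weight_ge0 // ler_nat; case: (boolP (unsep _ _ _)) => // /allP us.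
rewrite lt0b; apply/forallP => i; apply/negP => si.
have := us (s i) (codom_f _ _); rewrite /= (witness_sep (symg_simple w) uv _ kn si) //.
by rewrite guv.
Qed.

End ExpectedCost.

(** * Choice of the radius and of the number of landmarks *)

Section Main.
Variable R : realType.

Lemma ln_ge_half (x : R) : 2 <= x -> 2^-1 <= ln x.
Proof.
move=> x2; have x0 : 0 < x by lra.
by rewrite -ler_expR lnK ?posrE //; exact: le_trans (expR_half_le2 R) x2.
Qed.

Lemma power_bracket (D N : R) : 2 <= D -> 16 * D ^+ 2 <= N ->
  exists j, 16 * D ^+ j.+2 <= N /\ N < 16 * D ^+ j.+3.
Proof.
move=> D2 lo; have ex : exists i, N < 16 * D ^+ i.
  have N0 : 0 <= N by apply: le_trans lo; rewrite mulr_ge0 ?exprn_ge0 //; lra.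
  have /andP[_ Nk] := truncn_itv N0; set k := (Num.truncn N).+1 in Nk *; exists k.
  apply: lt_trans Nk _; apply: (@lt_le_trans _ _ (2 ^ k)%N%:R).
    by rewrite ltr_nat ltn_expl.
  rewrite natrX; apply: (@le_trans _ _ (D ^+ k)); first by rewrite lerXn2r ?nnegrE //; lra.
  by rewrite ler_peMl ?exprn_ge0 //; lra.
case: (ex_minnP ex) => i iN imin.
have i2 : (2 < i)%N.
  rewrite ltnNge; apply/negP => i2; move: iN; apply/negP; rewrite -leNgt.
  by apply: le_trans lo; rewrite ler_pM2l // ler_weXn2l //; lra.
case: i i2 iN imin => [|[|[|j]]] // _ iN imin; exists j; split=> //.
by rewrite leNgt; apply/negP => /imin; rewrite ltnn.
Qed.

Lemma card_vpairs_le n : (#|vpairs n| <= n * n)%N.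
Proof. by apply: leq_trans (max_card _) _; rewrite card_prod !card_ord. Qed.

Lemma card_vpairs_small n : (n <= 1)%N -> #|vpairs n| = 0%N.
Proof.
move=> n1; apply: eq_card0 => e; rewrite inE; apply/negbTE; rewrite -leqNgt.
by rewrite (leq_trans _ (leq0n _)) // -ltnS; exact: leq_trans (ltn_ord e.2) n1.
Qed.

Lemma average_cost_sparse (n : nat) (p : R) : (2 <= n)%N -> 0 <= p -> p <= 1 ->
  2000 * ln n%:R <= n%:R * p ->
  exists m, \sum_(s : seed n m) weight R s * expected_cost p (algo s)
    <= 2000 * (((n - 1)%:R * p) ^+ 2 * n%:R * ln n%:R).
Proof.
move=> n2 p0 p1; set N : R := n%:R; set l := ln N => np.
have N2 : 2 <= N by rewrite /N ler_nat.
have n0 : (0 < n)%N by apply: ltn_trans n2.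
have l0 : 2^-1 <= l := ln_ge_half N2.
have [D DE] : exists D, D = N * p + 1 by exists (N * p + 1).
have [d dE] : exists d, d = (n - 1)%:R * p by exists ((n - 1)%:R * p).
have nN : (n - 1)%:R = N - 1 :> R by rewrite natrB.
rewrite nN in dE; rewrite nN -dE.
have D0 : 1001 <= D by lra.
have d0 : 500 <= d.
  by have : 0 <= (N - 2) * p; [rewrite mulr_ge0 // subr_ge0 | rewrite dE; lra].
(* n - 1 >= n/2 gives Np <= 2d, and d >= 500 absorbs the 1; then (11/5)^2 < 5. *)
have Dd1 : D <= 11 / 5 * d.
  by have : 0 <= (N - 2) * p; [rewrite mulr_ge0 // subr_ge0 | rewrite dE; lra].
have NpD : N * p <= D by lra.
have hW j rho (u v : 'I_n) : 16 * D ^+ j.+2 <= N -> N < 16 * D ^+ j.+3 ->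
    256 * D ^+ 2 * l <= rho * N -> rho <= 1 -> u != v ->
    Ex p (fun w => expR (- (rho * #|witnesses (symg w) j.+1 u v|%:R))) <= 3 / N.
  by move=> jlo jhi rlo rho1; exact: (@witnesses_expR_le R n p p0 p1 j rho N l D).
clear np.
have Dd : D ^+ 2 <= 5 * d ^+ 2.
  apply: (@le_trans _ _ ((11 / 5 * d) ^+ 2)); first by clear DE; rewrite lerXn2r ?nnegrE //; lra.
  by rewrite exprMn ler_wpM2r ?sqr_ge0 //; lra.
have D2D : D <= D ^+ 2 by rewrite expr2 ler_peMl; lra.
have D2l : D ^+ 2 <= 2 * (D ^+ 2 * l).
  by have : 0 <= D ^+ 2 * (l - 2^-1); [rewrite mulr_ge0 ?sqr_ge0 // subr_ge0 | lra].
have vN : #|vpairs n|%:R <= N * N by rewrite -natrM ler_nat card_vpairs_le.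
have q0 : 500 <= D ^+ 2 * l by lra.
have finish x : x <= 260 * (D ^+ 2 * l) * N -> x <= 2000 * (d ^+ 2 * N * l).
  move=> /le_trans; apply.
  have : D ^+ 2 * (l * N) <= 5 * d ^+ 2 * (l * N).
    by apply: ler_wpM2r => //; apply: mulr_ge0; lra.
  have : 0 <= d ^+ 2 * (l * N) by rewrite mulr_ge0 ?sqr_ge0 // mulr_ge0; lra.
  lra.
have [q qE] : exists q, q = D ^+ 2 * l by exists (D ^+ 2 * l).
rewrite -qE in q0 finish D2l; clear d0 Dd1 Dd dE.
(* For small N no landmark is used and all at most N^2 <= 257 q N pairs are queried; for large N
   there is room for m <= 257 q <= N landmarks, so rho <= 1. *)
have [small|big] := ltP N (257 * q).
  exists 0%N; apply: finish; apply: le_trans (average_cost_trivial p0 p1 _) _; first by rewrite orbT.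
  rewrite muln0 add0n; apply: le_trans vN _; apply: ler_wpM2r; lra.
have [||j [jlo jhi]] := @power_bracket D N; [lra|lra|].
have q256 : 0 <= 256 * q by lra.
have /andP[m1 m2] := truncn_itv q256.
set m := (Num.truncn (256 * q)).+1 in m2 *.
exists m; apply: finish.
have mR : m%:R <= 257 * q by rewrite /m -natr1; lra.
have NN : 0 < N by lra.
have jn : (j.+2 < n)%N.
  have : (2 ^ j.+2)%N%:R <= N.
    rewrite natrX; apply: le_trans jlo; apply: (@le_trans _ _ (D ^+ j.+2)).
      by rewrite lerXn2r ?nnegrE //; lra.
    by rewrite ler_peMl ?exprn_ge0 //; lra.
  by rewrite ler_nat; apply: leq_trans; rewrite ltn_expl.
have rlo : 256 * D ^+ 2 * l <= m%:R / N * N.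
  by rewrite divfK ?gt_eqF // -mulrA -qE ltW.
have rho1 : m%:R / N <= 1 by rewrite ler_pdivrMr // mul1r; lra.
apply: le_trans (average_cost_le p0 p1 n0 jn (fun u v => hW j _ u v jlo jhi rlo rho1)) _.
rewrite natrM -/N.
have e1 : N * m%:R <= 257 * q * N by rewrite mulrC ler_wpM2r // ltW.
have e2 : #|vpairs n|%:R * (p + 3 / N) <= N * N * (p + 3 / N).
  by rewrite ler_wpM2r // addr_ge0 // divr_ge0 // ltW.
have e3 : N * N * (p + 3 / N) = N * (N * p + 3) by field; rewrite gt_eqF.
(* Adds 3 q N to the 257 q N of the first phase, whence the 260 in [finish]. *)
have e4 : N * (N * p + 3) <= N * (3 * q) by rewrite ler_wpM2l ?(ltW NN) //; lra.
lra.
Qed.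

End Main.

(* A randomized (Las Vegas) algorithm = a probability distribution w on a finite
   seed type S together with a deterministic query algorithm t s for each seed. *)
Theorem theorem1 (R : realType) (eps : R) :
  0 <= eps ->
  exists C : R, 0 < C /\
    forall (n : nat) (p : R),
      2000 * ln (n%:R) / n%:R <= p ->
      p <= (n%:R) `^ (- 2^-1 - eps) ->
      exists (S : finType) (w : S -> R) (t : S -> qtree n),
        (forall s, 0 <= w s) /\ \sum_(s : S) w s = 1 /\
        (forall s, reconstructs (t s)) /\
        \sum_(s : S) w s * expected_cost p (t s)
          <= C * (((n - 1)%:R * p) ^+ 2 * n%:R * ln (n%:R)).
Proof.
move=> eps0; exists 2000; split=> // n p plo phi.
suff [m [nm cost_le]] : exists m, ((0 < n)%N || (m == 0)%N) /\
    \sum_(s : seed n m) weight R s * expected_cost p (algo s)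
      <= 2000 * (((n - 1)%:R * p) ^+ 2 * n%:R * ln n%:R).
  exists (seed n m), (@weight R n m), (@algo n m); split; first exact: weight_ge0.
  split; first exact: sum_weight.
  by split=> // s; exact: landmark_tree_reconstructs.
(* Here the logarithm is 0, with ln 0 = 0 by convention, so the bound is 0; the algorithm without
   landmarks makes no query. *)
have [n1|n1] := leqP n 1.
  exists 0%N; rewrite orbT; split=> //.
  have ln0E : ln n%:R = 0 :> R by case: (n) n1 => [|[|]] // _; rewrite ?ln1 // ln0.
  rewrite ln0E mulr0 mul0r in plo.
  have p1 : p <= 1.
    apply: le_trans phi _; case: (n) n1 => [|[|]] // _; last by rewrite powR1.
    by rewrite powR0 //; lra.
  apply: le_trans (average_cost_trivial plo p1 _) _; first by rewrite orbT.
  by rewrite card_vpairs_small // muln0 ln0E !mulr0.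
have n0 : (0 < n)%N by apply: ltn_trans n1.
have nR : 1 <= n%:R :> R by rewrite ler1n.
(* The base is at least 1 and the exponent negative. *)
have p1 : p <= 1.
  by apply: le_trans phi _; rewrite -[leRHS](powRr0 n%:R) ler_powR //; lra.
have l0 : 0 <= ln n%:R :> R by rewrite ln_ge0.
have p0 : 0 <= p by apply: le_trans plo; rewrite divr_ge0 // mulr_ge0.
have np : 2000 * ln n%:R <= n%:R * p.
  by rewrite [leRHS]mulrC -ler_pdivrMr ?ltr0n.
have [m mle] := average_cost_sparse n1 p0 p1 np.
by exists m; rewrite n0.
Qed.
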